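(* Let $A\in\mathbb{R}^{m\times n}$ with $m\ge n$, let $[a,b]\subset[\sigma_{\min}(A),\|A\|]$, let $P$ be the Chebyshev--Jackson approximate spectral projector of degree $d$ of $S=A^TA$ for $[a,b]$ with eigenpairs $(\gamma_i,v_i)$, and let $n_{sv}\le p<n$. Let $\hat V^{(0)}\in\mathbb{R}^{n\times p}$ have orthonormal columns and let $Q_1^{(k)}$ and $\hat\sigma_1^{(k)},\dots,\hat\sigma_p^{(k)}$, $k\ge1$, be generated by the CJ-FEAST SVDsolver. Suppose that $V_p^T\hat V^{(0)}$ is invertible and $\gamma_p>\gamma_{p+1}$. Then $$Q_1^{(k)}=(V_p+V_{p,\perp}E^{(k)})(M^{(k)})^{-\frac12}U^{(k)}$$ with $$E^{(0)}=V_{p,\perp}^T\hat V^{(0)}(V_p^T\hat V^{(0)})^{-1},\qquad E^{(k)}=(\Gamma_p^{\prime})^{k}E^{(0)}\Gamma_p^{-k},\qquad M^{(k)}=I+(E^{(k)})^TE^{(k)}$$ and $U^{(k)}$ an orthogonal matrix; furthermore, $$\|E^{(k)}\|\le\left(\frac{\gamma_{p+1}}{\gamma_p}\right)^k\|E^{(0)}\|,$$ and the distance $\epsilon_k:=\mathrm{dist}(\mathrm{span}\{Q_1^{(k)}\},\mathrm{span}\{V_p\})$ satisfies $$\epsilon_k=\frac{\|E^{(k)}\|}{\sqrt{1+\|E^{(k)}\|^2}}\le\left(\frac{\gamma_{p+1}}{\gamma_p}\right)^k\|E^{(0)}\|.$$ Label $\hat\sigma_1^{(k)},\dots,\hat\sigma_p^{(k)}$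 in the same order as $\sigma_1,\dots,\sigma_p$ (i.e. so that $\hat\sigma_i^{(k)}\le\hat\sigma_j^{(k)}$ whenever $\sigma_i<\sigma_j$). Then $$|(\hat\sigma_i^{(k)})^2-\sigma_i^2|\le\|A\|^2(3\epsilon_k^2+\epsilon_k^4),\qquad i=1,2,\ldots,n_{sv}.$$
   Context: $\|\cdot\|$ is the 2-norm (spectral norm for matrices); $\mathrm{span}\{X\}$ is the column space of $X$; $\mathrm{dist}(\mathcal X,\mathcal Y)=\|\Pi_{\mathcal X}-\Pi_{\mathcal Y}\|$ for equidimensional subspaces, where $\Pi$ denotes orthogonal projectors. Approximate projector. With $\sigma_{\min}=\sigma_{\min}(A)$ let $l(x)=\frac{2x-\|A\|^2-\sigma_{\min}^2}{\|A\|^2-\sigma_{\min}^2}$, $\alpha=\arccos(l(a^2))$, $\beta=\arccos(l(b^2))$. Let $\psi_d(x)=\frac{c_0}{2}+\sum_{j=1}^d\rho_{j,d}c_jT_j(x)$ with $T_j$ the Chebyshev polynomials of the first kind, $c_0=\frac2\pi(\alpha-\beta)$, $c_j=\frac2\pi\frac{\sin(j\alpha)-\sin(j\beta)}{j}$ for $j\ge1$, and $\rho_{j,d}=\frac{(d+2-j)\sin(\frac{\pi}{d+2})\cos(\frac{j\pi}{d+2})+\cos(\frac{\pi}{d+2})\sin(\frac{j\pi}{d+2})}{(d+2)\sin\frac{\pi}{d+2}}$. Then $P=\psi_d(l(S))$, a symmetric matrix whose eigenvalues $\gamma_i=\psi_d(l(\sigma_i^2))$ lie in $[0,1]$. Labeling.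 $\sigma_1,\dots,\sigma_n$ are the singular values of $A$ with orthonormal right singular vectors $v_1,\dots,v_n$ ($Sv_i=\sigma_i^2v_i$, $Pv_i=\gamma_iv_i$), labeled so that $\sigma_1,\dots,\sigma_{n_{sv}}$ are exactly the singular values in $[a,b]$ (with multiplicity) and $\gamma_1\ge\gamma_2\ge\cdots\ge\gamma_n$. Put $V_p=[v_1,\dots,v_p]$, $V_{p,\perp}=[v_{p+1},\dots,v_n]$, $\Gamma_p=\mathrm{diag}(\gamma_1,\dots,\gamma_p)$, $\Gamma_p'=\mathrm{diag}(\gamma_{p+1},\dots,\gamma_n)$. CJ-FEAST SVDsolver. For $k=1,2,\dots$: compute $Y^{(k)}=P\hat V^{(k-1)}$; thin QR factorizations $Y^{(k)}=Q_1^{(k)}R_1^{(k)}$ and $AQ_1^{(k)}=Q_2^{(k)}\bar A^{(k)}$ with $Q_1^{(k)}\in\mathbb{R}^{n\times p}$, $Q_2^{(k)}\in\mathbb{R}^{m\times p}$ having orthonormal columns; the SVD $\bar A^{(k)}=\bar U^{(k)}\hat\Sigma^{(k)}(\bar V^{(k)})^T$ with $\hat\Sigma^{(k)}=\mathrm{diag}(\hat\sigma_1^{(k)},\dots,\hat\sigma_p^{(k)})$; and set $\hat U^{(k)}=Q_2^{(k)}\bar U^{(k)}$, $\hat V^{(k)}=Q_1^{(k)}\bar V^{(k)}$. *)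

(* Defs.v *)
From HB Require Import structures.
From mathcomp Require Import all_boot all_order all_algebra all_fingroup.
From mathcomp Require Import all_classical all_reals all_analysis.

Set Implicit Arguments.
Unset Strict Implicit.
Unset Printing Implicit Defensive.

Import Order.TTheory GRing.Theory Num.Theory.
Local Open Scope classical_set_scope.
Local Open Scope ring_scope.

(* The norm that the analysis library puts on matrices is the max norm, hence
   the explicit Euclidean and spectral norms. *)
Definition norm2 {R : realType} {n : nat} (x : 'cV[R]_n) : R :=
  Num.sqrt (\sum_i x i 0 ^+ 2).

Definition mxnorm2 {R : realType} {m n : nat} (B : 'M[R]_(m, n)) : R :=
  sup [set norm2 (B *m x) | x in [set x : 'cV[R]_n | norm2 x <= 1]].

(* For m >= n, these are the singular values of the m x n matrix A; eigenvalue
   is about row eigenvectors, but A^T A is symmetric. *)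
Definition singular_value {R : realType} {m n : nat} (A : 'M[R]_(m, n)) (s : R)
    : Prop :=
  0 <= s /\ eigenvalue (A^T *m A) (s ^+ 2).

Definition sigma_min {R : realType} {m n : nat} (A : 'M[R]_(m, n)) : R :=
  inf [set s | singular_value A s].

Definition orthonormal_cols {R : realType} {n p : nat} (Q : 'M[R]_(n, p))
    : Prop :=
  Q^T *m Q = 1%:M.

(* The principal square root of a positive semidefinite symmetric matrix. *)
Definition psdmx {R : realType} {n : nat} (M : 'M[R]_n) : Prop :=
  M^T = M /\ forall x : 'cV[R]_n, 0 <= (x^T *m M *m x) 0 0.

Definition sqrtmx {R : realType} {n : nat} (M : 'M[R]_n) : 'M[R]_n :=
  xget 0 [set N | psdmx N /\ N *m N = M].

(* The orthogonal projector onto the column space of X; mxalgebra compares row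
   spaces, hence the transposes. *)
Definition orthproj {R : realType} {n p : nat} (X : 'M[R]_(n, p)) : 'M[R]_n :=
  xget 0 [set Pi | [/\ Pi^T = Pi, Pi *m Pi = Pi & (Pi^T == X^T)%MS]].

Definition span_dist {R : realType} {n p q : nat}
    (X : 'M[R]_(n, p)) (Y : 'M[R]_(n, q)) : R :=
  mxnorm2 (orthproj X - orthproj Y).

Fixpoint chebyshev {R : realType} (j : nat) : {poly R} :=
  match j with
  | 0 => 1
  | 1 => 'X
  | (i.+1 as k).+1 => 2 *: ('X * chebyshev k) - chebyshev i
  end.

Definition jackson {R : realType} (d j : nat) : R :=
  let t : R := pi / (d + 2)%:R in
  (((d + 2)%:R - j%:R) * sin t * cos (j%:R * t) + cos t * sin (j%:R * t))
  / ((d + 2)%:R * sin t).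

(* The Jackson-damped Chebyshev expansion of the indicator function of
   [cos alpha, cos beta]. *)
Definition cj_series {R : realType} (d : nat) (alpha beta : R) : {poly R} :=
  ((2 / pi * (alpha - beta)) / 2)%:P
  + \sum_(1 <= j < d.+1)
      (jackson d j
       * (2 / pi * ((sin (j%:R * alpha) - sin (j%:R * beta)) / j%:R)))
      *: chebyshev j.

(* The affine polynomial l, mapping [sigma_min^2, |A|^2] onto [-1, 1]. *)
Definition cj_affine {R : realType} {m n : nat} (A : 'M[R]_(m, n)) : {poly R} :=
  (mxnorm2 A ^+ 2 - sigma_min A ^+ 2)^-1
  *: (2 *: 'X - (mxnorm2 A ^+ 2 + sigma_min A ^+ 2)%:P).

Definition cj_filter {R : realType} {m n : nat} (A : 'M[R]_(m, n)) (a b : R)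
    (d : nat) : {poly R} :=
  cj_series d (acos (cj_affine A).[a ^+ 2]) (acos (cj_affine A).[b ^+ 2]).

Definition cj_projector {R : realType} {m n : nat} (A : 'M[R]_(m, n.+1))
    (a b : R) (d : nat) : 'M[R]_n.+1 :=
  horner_mx (horner_mx (A^T *m A) (cj_affine A)) (cj_filter A a b d).

Definition cj_eigenvalue {R : realType} {m n : nat} (A : 'M[R]_(m, n))
    (a b : R) (d : nat) (s : R) : R :=
  (cj_filter A a b d).[(cj_affine A).[s ^+ 2]].

(* is_trig_mx means lower triangular. *)
Definition thin_QR {R : realType} {n p : nat}
    (Y Q : 'M[R]_(n, p)) (T : 'M[R]_p) : Prop :=
  [/\ Y = Q *m T, orthonormal_cols Q & is_trig_mx T^T].

(* No ordering of the singular values s is imposed. *)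
Definition square_SVD {R : realType} {p : nat}
    (B U : 'M[R]_p) (s : 'rV[R]_p) (W : 'M[R]_p) : Prop :=
  [/\ B = U *m diag_mx s *m W^T, orthonormal_cols U, orthonormal_cols W
    & forall i, 0 <= s 0 i].

Record cj_iterate (R : realType) (m n p : nat) := CJIterate {
  cjY : 'M[R]_(n, p);
  cjQ1 : 'M[R]_(n, p);
  cjR1 : 'M[R]_p;
  cjQ2 : 'M[R]_(m, p);
  cjAbar : 'M[R]_p;
  cjUbar : 'M[R]_p;
  cjsigma : 'rV[R]_p;
  cjVbar : 'M[R]_p;
  cjUhat : 'M[R]_(m, p);
  cjVhat : 'M[R]_(n, p)
}.

Definition cj_step {R : realType} {m n p : nat} (A : 'M[R]_(m, n))
    (P : 'M[R]_n) (Vprev : 'M[R]_(n, p)) (s : cj_iterate R m n p) : Prop :=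
  cjY s = P *m Vprev
  /\ [/\ thin_QR (cjY s) (cjQ1 s) (cjR1 s),
         thin_QR (A *m cjQ1 s) (cjQ2 s) (cjAbar s),
         square_SVD (cjAbar s) (cjUbar s) (cjsigma s) (cjVbar s),
         cjUhat s = cjQ2 s *m cjUbar s
       & cjVhat s = cjQ1 s *m cjVbar s].

(* Of it 0, only the component cjVhat (it 0), the starting matrix, matters. *)
Definition cj_feast {R : realType} {m n p : nat} (A : 'M[R]_(m, n))
    (P : 'M[R]_n) (V0 : 'M[R]_(n, p)) (it : nat -> cj_iterate R m n p) : Prop :=
  cjVhat (it 0%N) = V0 /\ forall k, cj_step A P (cjVhat (it k)) (it k.+1).

Definition ord_tail {n p : nat} (le_pn : (p <= n)%N) (j : 'I_(n - p)) : 'I_n :=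
  cast_ord (subnKC le_pn) (rshift p j).

Definition Vhead {R : realType} {n p : nat} (le_pn : (p <= n)%N)
    (V : 'M[R]_n) : 'M[R]_(n, p) :=
  colsub (widen_ord le_pn) V.

Definition Vtail {R : realType} {n p : nat} (le_pn : (p <= n)%N)
    (V : 'M[R]_n) : 'M[R]_(n, n - p) :=
  colsub (ord_tail le_pn) V.

Definition Ghead {R : realType} {n p : nat} (le_pn : (p <= n)%N)
    (g : 'I_n -> R) : 'M[R]_p :=
  diag_mx (\row_j g (widen_ord le_pn j)).

Definition Gtail {R : realType} {n p : nat} (le_pn : (p <= n)%N)
    (g : 'I_n -> R) : 'M[R]_(n - p) :=
  diag_mx (\row_j g (ord_tail le_pn j)).

Definition Emx {R : realType} {n p : nat} (le_pn : (p <= n)%N)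
    (V : 'M[R]_n) (g : 'I_n -> R) (V0 : 'M[R]_(n, p)) (k : nat)
    : 'M[R]_(n - p, p) :=
  let E0 := (Vtail le_pn V)^T *m V0 *m invmx ((Vhead le_pn V)^T *m V0) in
  (Gtail le_pn g ^+ k) *m E0 *m invmx (Ghead le_pn g ^+ k).

(* Main.v *)
Require Import Defs.
From mathcomp Require Import complex.
From mathcomp Require Import all_boot all_order all_algebra all_fingroup.
From mathcomp Require Import all_classical all_reals all_analysis.
From mathcomp Require Import ring lra.

Set Implicit Arguments.
Unset Strict Implicit.
Unset Printing Implicit Defensive.

Import Order.TTheory GRing.Theory Num.Theory.
Local Open Scope ring_scope.

(** The iteration is block power iteration for [P] followed by Rayleigh-Ritz.
    The bases [Vp], [Vperp] of eigenvectors split the space orthogonally.  A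
    [p]-dimensional subspace meeting [span Vperp] only in zero is a graph over
    [span Vp]: it is spanned by [Vp + Vperp E] for a unique [E].  As [P] acts
    diagonally in this splitting, applying it turns [E] into
    [Gamma' E Gamma^-1], while QR and the Ritz rotation only change the basis of
    the graph ([cj_feast_graph]).  The contraction factor
    [gamma_(p+1) / gamma_p] then follows because the eigenvalues of [P] are
    nonnegative.

    This nonnegativity ([cj_eigenvalue_ge0]) is the positivity of the Jackson
    kernel [1/2 + sum_j rho_j cos (j x)].  The damping factors [rho_j] are
    normalized autocorrelations of the sequence [sin (k pi / (d + 2))], so that
    the kernel is a positive multiple of the squared modulus of a trigonometric
    sum.  The filter at [cos x] is a combination of four values of a primitive of this
    kernel, arranged as two increments, and the primitive is nondecreasing.

    For an orthonormal basis [Q = (Vp + Vperp E) X] of the graph,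
    [X^T (1 + E^T E) X = 1], so [U = (1 + E^T E)^(1/2) X] is orthogonal and [Q]
    has the announced polar form ([graph_polar]).  The principal square root
    exists by the complex spectral theorem: some real polynomial takes the value
    [l^(1/4)] at each eigenvalue [l], and the root is the square of the value of
    this polynomial at the matrix ([sqrtmxP]).

    The formula for the distance is proved as two inequalities
    ([projector_dist_le], [projector_dist_ge]), both from the Pythagorean
    identity [|(Vp + Vperp E) u|^2 = |u|^2 + |E u|^2].

    For the Ritz values, the part of [Q x] outside [span Vp] has norm at most
    [eps |x|] because it is the difference of the two projectors applied to
    [Q x].  The energies [|A Q x|^2] and [sum_j sigma_j^2 (Vp^T Q x)_j^2]
    therefore differ by at most [|A|^2 eps^2 |x|^2], and a
    Courant-Fischer argument ([ritz_value_error]) gives the bound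
    [|A|^2 eps^2], which implies the one claimed. *)

(** * Positivity of the damped Chebyshev filter *)

Lemma chebyshev_cos (R : realType) (x : R) (j : nat) :
  (Defs.chebyshev j).[cos x] = cos (j%:R * x).
Proof.
suff : (Defs.chebyshev j).[cos x] = cos (j%:R * x)
    /\ (Defs.chebyshev j.+1).[cos x] = cos (j.+1%:R * x) by case.
elim: j => [|j [IH1 IH2]]; first by rewrite /= mul0r cos0 mul1r !hornerE.
split=> //.
have -> : Defs.chebyshev j.+2 = 2 *: ('X * Defs.chebyshev j.+1) - Defs.chebyshev j :> {poly R}.
  by [].
rewrite hornerD hornerN hornerZ hornerM hornerX IH1 IH2.
have -> : j.+2%:R * x = j.+1%:R * x + x by rewrite -[j.+2]addn1 natrD mulrDl mul1r.
have -> : cos (j%:R * x) = cos (j.+1%:R * x - x).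
  by congr cos; rewrite -[j.+1]addn1 natrD; ring.
rewrite cosB cosD; ring.
Qed.

(** Multiplied by [sin t], the sum telescopes: each summand is
    [cos (j t) - cos ((2 k + j) t)], and
    [2 sin t cos ((2 k + j) t) = sin ((2 k + j + 1) t) - sin ((2 k + j - 1) t)]. *)
Lemma sum_sin_shift (R : realType) (t : R) (j N : nat) :
  sin t * \sum_(k < N) 2 * (sin (k%:R * t) * sin ((k + j)%:R * t))
  = N%:R * sin t * cos (j%:R * t)
    - (sin ((2 * N%:R + j%:R - 1) * t) - sin ((j%:R - 1) * t)) / 2.
Proof.
elim: N => [|N IH].
  by rewrite big_ord0 !mulr0 add0r subrr !mul0r subr0.
rewrite big_ord_recr mulrDr IH /=.
set c := (2 * N%:R + j%:R) * t.
have -> : (2 * N%:R + j%:R - 1) * t = c - t by rewrite /c; ring.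
have -> : (2 * N.+1%:R + j%:R - 1) * t = c + t.
  by rewrite /c -(natr1 N); ring.
have -> : cos (j%:R * t) = cos ((N + j)%:R * t - N%:R * t).
  by rewrite natrD; congr cos; ring.
have cE : c = (N + j)%:R * t + N%:R * t by rewrite /c natrD; ring.
rewrite -(natr1 N) [sin (c + t)]sinD [sin (c - t)]sinB.
by rewrite cE cosB cosD sinD; field.
Qed.

Lemma jackson_angle_sin_gt0 (R : realType) (d : nat) :
  0 < sin (pi / (d + 2)%:R : R).
Proof.
apply: sin_gt0_pi; rewrite divr_gt0 ?pi_gt0 ?ltr0n ?addn2 //=.
by rewrite ltr_pdivrMr ?ltr0n // ltr_pMr ?pi_gt0 // ltr1n.
Qed.

(** The reason for the shape of the Jackson coefficients: being normalized
    autocorrelations, they turn the damped Dirichlet kernel into a multiple of a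
    squared modulus. *)
Lemma jackson_autocorrelation (R : realType) (d j : nat) :
  let w k : R := sin (k%:R * (pi / (d + 2)%:R)) in
  (j <= d + 2)%N ->
  (d + 2)%:R * jackson d j = \sum_(k < d + 2 - j) 2 * (w k * w (k + j)%N).
Proof.
move=> w jd; have := jackson_angle_sin_gt0 R d; rewrite /jackson.
have N0 : (d + 2)%:R != 0 :> R by rewrite pnatr_eq0 addn2.
set t := pi / _ => st.
apply: (mulfI (lt0r_neq0 st)).
rewrite sum_sin_shift.
(* As [(d + 2) t = pi], the upper end of the telescoped sum contributes
   [- sin ((j + 1) t)]; with the lower end this makes [2 cos t sin (j t)]. *)
have -> : (2 * (d + 2 - j)%:R + j%:R - 1) * t = - (j%:R * t + t) + pi *+ 2.
  by rewrite natrB // /t mulr2n; field.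
have -> : (j%:R - 1) * t = j%:R * t - t by ring.
rewrite sinD2pi sinN sinD sinB natrB //.
by field; rewrite -?natrD ?N0 ?lt0r_neq0.
Qed.

(** The left side is [|sum_k w_k e^(i k x)|^2]; the right side collects the
    terms of the double sum by the difference [j] of the two indices. *)
Lemma square_modulus_trig_sum (R : realType) (w : nat -> R) (x : R) (N : nat) :
  (\sum_(k < N) w k * cos (k%:R * x)) ^+ 2
  + (\sum_(k < N) w k * sin (k%:R * x)) ^+ 2
  = \sum_(k < N) w k ^+ 2
    + \sum_(1 <= j < N) cos (j%:R * x) * \sum_(k < N - j) 2 * (w k * w (k + j)%N).
Proof.
elim: N => [|N IH]; first by rewrite !big_ord0 big_geq // expr0n !addr0.
rewrite !big_ord_recr /=.
set C := \sum_(k < N) _ in IH *; set S := \sum_(k < N) _ in IH *.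
set W := \sum_(k < N) _ in IH *.
have step : \sum_(1 <= j < N.+1) cos (j%:R * x) *
       (\sum_(k < N.+1 - j) 2 * (w k * w (k + j)%N))
  = \sum_(1 <= j < N) cos (j%:R * x) *
       (\sum_(k < N - j) 2 * (w k * w (k + j)%N))
    + \sum_(1 <= j < N.+1) cos (j%:R * x) * (2 * (w (N - j)%N * w N)).
  transitivity (\sum_(1 <= j < N.+1) (cos (j%:R * x) *
       (\sum_(k < N - j) 2 * (w k * w (k + j)%N))
    + cos (j%:R * x) * (2 * (w (N - j)%N * w N)))).
    apply: eq_big_nat => j /andP[j1 jN].
    by rewrite subSn // big_ord_recr mulrDr /= subnK.
  rewrite big_split /=; congr (_ + _).
  case: (N) => [|M]; first by rewrite !big_geq.
  by rewrite [LHS]big_nat_recr //= subnn big_ord0 mulr0 addr0.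
have rev_sum : \sum_(1 <= j < N.+1) cos (j%:R * x) * (2 * (w (N - j)%N * w N))
  = 2 * w N * (C * cos (N%:R * x) + S * sin (N%:R * x)).
  rewrite !mulr_suml -big_split big_distrr /= big_add1 /= big_mkord.
  rewrite (reindex_inj rev_ord_inj) /=; apply: eq_bigr => k _.
  have kN : (k < N)%N := ltn_ord k.
  have kE : (N - k.+1).+1 = (N - k)%N by rewrite -subSn.
  rewrite kE subKn 1?ltnW // natrB 1?ltnW // mulrBl cosB; ring.
rewrite step rev_sum.
have := cos2Dsin2 (N%:R * x).
set c := cos (N%:R * x); set s := sin (N%:R * x) => cs.
transitivity (C ^+ 2 + S ^+ 2 + w N ^+ 2 * (c ^+ 2 + s ^+ 2)
  + 2 * w N * (C * c + S * s)); first by ring.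
by rewrite IH cs; ring.
Qed.

Definition jackson_kernel {R : realType} (d : nat) (x : R) : R :=
  2^-1 + \sum_(1 <= j < d.+1) jackson d j * cos (j%:R * x).

Lemma jackson_kernel_ge0 (R : realType) (d : nat) (x : R) :
  0 <= jackson_kernel d x.
Proof.
set w : nat -> R := fun k => sin (k%:R * (pi / (d + 2)%:R)).
have N0 : 0 < (d + 2)%:R :> R by rewrite ltr0n addn2.
suff : 0 <= (d + 2)%:R * jackson_kernel d x by rewrite pmulr_rge0.
suff -> : (d + 2)%:R * jackson_kernel d x
    = (\sum_(k < d + 2) w k * cos (k%:R * x)) ^+ 2
      + (\sum_(k < d + 2) w k * sin (k%:R * x)) ^+ 2.
  by rewrite addr_ge0 ?sqr_ge0.
rewrite square_modulus_trig_sum /jackson_kernel mulrDr; congr (_ + _).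
  have := jackson_autocorrelation R (leq0n (d + 2)).
  rewrite /jackson subn0 !mul0r cos0 sin0 subr0 mulr1 mulr0 addr0.
  rewrite divff ?mulf_neq0 ?lt0r_neq0 ?jackson_angle_sin_gt0 //.
  rewrite mulr1 => ->; rewrite mulr_suml; apply: eq_bigr => k _.
  by rewrite addn0 -/(w k); field.
(* The squared modulus has one more frequency, [j = d + 1], than the kernel; its
   only term contains [w 0 = 0]. *)
rewrite addn2 [RHS]big_nat_recr //=.
have -> : (d.+2 - d.+1 = 1)%N by rewrite subSn // subnn.
have w0 : w 0%N = 0 by rewrite /w mul0r sin0.
rewrite big_ord_recl big_ord0 /= w0 mul0r mulr0 addr0 mulr0 addr0.
rewrite big_distrr /=; apply: eq_big_nat => j /andP[_ jd].
rewrite -[in LHS](addn2 d) mulrA jackson_autocorrelation; last first.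
  by rewrite (leq_trans (ltnW jd)) // addn2 ltnW.
by rewrite [LHS]mulrC -[in RHS](addn2 d).
Qed.

Definition jackson_primitive {R : realType} (d : nat) (x : R) : R :=
  x / 2 + \sum_(1 <= j < d.+1) jackson d j * (sin (j%:R * x) / j%:R).

Lemma is_derive_jackson_primitive (R : realType) (d : nat) (x : R) :
  is_derive x 1 (@jackson_primitive R d) (jackson_kernel d x).
Proof.
rewrite /jackson_primitive /jackson_kernel; move: (jackson d) => c.
apply: is_deriveD.
  have -> : (fun y : R => y / 2) = 2^-1 \*: id.
    by apply/funext => y; rewrite /= mulrC.
  by apply: is_derive_eq; rewrite /GRing.scale /= mulr1.
elim: d => [|d IH].
  rewrite big_geq //.
  have -> : (fun y : R => \sum_(1 <= j < 1) c j * (sin (j%:R * y) / j%:R))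
    = cst 0 by apply/funext => y; rewrite big_geq.
  exact: is_derive_cst.
rewrite big_nat_recr //=.
have -> : (fun y : R => \sum_(1 <= j < d.+2) c j * (sin (j%:R * y) / j%:R))
  = (fun y : R => \sum_(1 <= j < d.+1) c j * (sin (j%:R * y) / j%:R))
    + (c d.+1 / d.+1%:R) \*: (sin \o (d.+1%:R \*: id)).
  apply/funext => y; rewrite big_nat_recr //= /GRing.add /=.
  by congr (_ + _); rewrite /GRing.scale /=; ring.
apply: is_deriveD; apply: is_derive_eq.
rewrite /GRing.scale /= mulr1; field.
by rewrite ?nat1r ?natr1 pnatr_eq0.
Qed.

Lemma jackson_primitive_ndecr (R : realType) (d : nat) (x y : R) :
  x <= y -> jackson_primitive d x <= jackson_primitive d y.
Proof.
move=> xy.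
have D (z : R) := is_derive_jackson_primitive d z.
apply: (@ger0_derive1_ndecr R _ x y) => // [z _|].
- by rewrite derive1E; have [_ ->] := D z; apply: jackson_kernel_ge0.
- by apply: derivable_within_continuous => z _; have [] := D z.
Qed.

(** Since [2 sin (j al) cos (j x) = sin (j (al + x)) + sin (j (al - x))], the
    filter is a sum of increments of the primitive, one over
    [[be + x, al + x]] and one over [[be - x, al - x]]; this is the convolution
    of the indicator function with the kernel, without integrals. *)
Lemma cj_series_cosE (R : realType) (d : nat) (al be x : R) :
  pi * (cj_series d al be).[cos x]
  = jackson_primitive d (al + x) + jackson_primitive d (al - x)
    - jackson_primitive d (be + x) - jackson_primitive d (be - x).
Proof.
rewrite /cj_series hornerD hornerC horner_sum /jackson_primitive.
have : pi != 0 :> R by rewrite lt0r_neq0 ?pi_gt0.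
move: (jackson d) (@pi R) => rho c c0.
pose F (y : R) := \sum_(1 <= j < d.+1) rho j * (sin (j%:R * y) / j%:R).
rewrite -!/(F _).
suff E : c * (\sum_(1 <= j < d.+1) ((rho j * (2 / c *
      ((sin (j%:R * al) - sin (j%:R * be)) / j%:R))) *: Defs.chebyshev j).[cos x])
    = F (al + x) + F (al - x) - F (be + x) - F (be - x).
  by rewrite mulrDr E; field.
rewrite /F big_distrr -big_split -!sumrB /=; apply: eq_big_nat => j /andP[j1 _].
rewrite hornerZ chebyshev_cos !mulrDr !mulrN !sinD !sinN !cosN.
by field; rewrite pnatr_eq0 -lt0n j1.
Qed.

Lemma cj_series_ge0 (R : realType) (d : nat) (al be y : R) :
  be <= al -> -1 <= y <= 1 -> 0 <= (cj_series d al be).[y].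
Proof.
move=> ba y1; rewrite -(@acosK R y) ?in_itv //=.
have : 0 <= pi * (cj_series d al be).[cos (acos y)].
  rewrite cj_series_cosE.
  have H1 : jackson_primitive d (be + acos y) <= jackson_primitive d (al + acos y).
    by apply: jackson_primitive_ndecr; rewrite lerD2r.
  have H2 : jackson_primitive d (be - acos y) <= jackson_primitive d (al - acos y).
    by apply: jackson_primitive_ndecr; rewrite lerD2r.
  lra.
by rewrite pmulr_rge0 ?pi_gt0.
Qed.

Lemma acos_nincr (R : realType) (x y : R) :
  -1 <= x -> x <= y -> y <= 1 -> acos y <= acos x.
Proof.
move=> x1 xy y1.
have hx : -1 <= x <= 1 by rewrite x1 (le_trans xy).
have hy : -1 <= y <= 1 by rewrite y1 (le_trans x1).
rewrite leNgt; apply/negP; rewrite -ltr_cos ?in_itv /= ?acos_ge0 ?acos_lepi //.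
by rewrite !acosK ?in_itv //= ltNge xy.
Qed.

(** * Dot products, spectral norm and orthogonal projectors *)

Definition dotv {R : realType} {n : nat} (x y : 'cV[R]_n) : R :=
  (x^T *m y) 0 0.

Section DotProduct.
Context {R : realType}.
Implicit Types (m n p : nat).

Lemma dotvE n (x y : 'cV[R]_n) : dotv x y = \sum_i x i 0 * y i 0.
Proof. by rewrite /dotv mxE; apply: eq_bigr => i _; rewrite mxE. Qed.

Lemma dotvC n (x y : 'cV[R]_n) : dotv x y = dotv y x.
Proof. by rewrite !dotvE; apply: eq_bigr => i _; rewrite mulrC. Qed.

Lemma dotvDl n (x y z : 'cV[R]_n) : dotv (x + y) z = dotv x z + dotv y z.
Proof. by rewrite /dotv linearD mulmxDl mxE. Qed.

Lemma dotvDr n (x y z : 'cV[R]_n) : dotv z (x + y) = dotv z x + dotv z y.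
Proof. by rewrite /dotv mulmxDr mxE. Qed.

Lemma dotvZl n (c : R) (x y : 'cV[R]_n) : dotv (c *: x) y = c * dotv x y.
Proof. by rewrite /dotv linearZ -scalemxAl mxE. Qed.

Lemma dotvZr n (c : R) (x y : 'cV[R]_n) : dotv x (c *: y) = c * dotv x y.
Proof. by rewrite /dotv -scalemxAr mxE. Qed.

Lemma dotvNl n (x y : 'cV[R]_n) : dotv (- x) y = - dotv x y.
Proof. by rewrite -scaleN1r dotvZl mulN1r. Qed.

Lemma dotvNr n (x y : 'cV[R]_n) : dotv x (- y) = - dotv x y.
Proof. by rewrite dotvC dotvNl dotvC. Qed.

Lemma dotvD_orth n (x y : 'cV[R]_n) :
  dotv x y = 0 -> dotv (x + y) (x + y) = dotv x x + dotv y y.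
Proof. by move=> xy; rewrite dotvDl !dotvDr (dotvC y x) xy addr0 add0r. Qed.

Lemma dotvB_orth n (x y : 'cV[R]_n) :
  dotv x y = 0 -> dotv (x - y) (x - y) = dotv x x + dotv y y.
Proof.
by move=> xy; rewrite dotvD_orth dotvNr ?xy ?oppr0 // dotvNl opprK.
Qed.

Lemma dotv_mull m n (B : 'M[R]_(m, n)) (x : 'cV[R]_n) (y : 'cV[R]_m) :
  dotv (B *m x) y = dotv x (B^T *m y).
Proof. by rewrite /dotv trmx_mul mulmxA. Qed.

Lemma dotv_ge0 n (x : 'cV[R]_n) : 0 <= dotv x x.
Proof. by rewrite dotvE sumr_ge0 // => i _; rewrite -expr2 sqr_ge0. Qed.

Lemma dotv_eq0 n (x : 'cV[R]_n) : (dotv x x == 0) = (x == 0).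
Proof.
apply/eqP/eqP => [|->]; last by rewrite /dotv mulmx0 mxE.
rewrite dotvE => /eqP; rewrite psumr_eq0; last first.
  by move=> i _; rewrite -expr2 sqr_ge0.
move=> /allP x0; apply/colP => i; rewrite mxE.
have := x0 i; rewrite mem_index_enum => /(_ isT) /=.
by rewrite -expr2 sqrf_eq0 => /eqP.
Qed.

Lemma dotv_gt0 n (x : 'cV[R]_n) : x != 0 -> 0 < dotv x x.
Proof. by move=> x0; rewrite lt_def dotv_ge0 dotv_eq0 x0. Qed.

Lemma dotv_cauchy_schwarz n (x y : 'cV[R]_n) :
  dotv x y ^+ 2 <= dotv x x * dotv y y.
Proof.
have [->|x0] := eqVneq x 0.
  by rewrite /dotv trmx0 !mul0mx mxE mul0r expr0n.
have := dotv_ge0 (dotv x x *: y - dotv x y *: x).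
rewrite dotvDl !dotvDr !dotvNl !dotvNr !dotvZl !dotvZr (dotvC y x).
have := dotv_gt0 x0; set a := dotv x x; set b := dotv y y; set c := dotv x y.
move=> a0 H; have : 0 <= a * (a * b - c ^+ 2) by move: H; rewrite expr2; lra.
by rewrite pmulr_rge0 // subr_ge0.
Qed.

Lemma dotv_isometry n p (Q : 'M[R]_(n, p)) (x y : 'cV[R]_p) :
  orthonormal_cols Q -> dotv (Q *m x) (Q *m y) = dotv x y.
Proof. by move=> QQ; rewrite dotv_mull mulmxA QQ mul1mx. Qed.

Lemma dotv_diag n (d : 'rV[R]_n) (x : 'cV[R]_n) :
  dotv x (diag_mx d *m x) = \sum_i d 0 i * x i 0 ^+ 2.
Proof.
by rewrite dotvE; apply: eq_bigr => i _; rewrite mul_diag_mx mxE; ring.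
Qed.

Lemma dotv_sum_sqr n (x : 'cV[R]_n) : dotv x x = \sum_i x i 0 ^+ 2.
Proof. by rewrite dotvE; apply: eq_bigr => i _; rewrite expr2. Qed.

Lemma norm2_dotv n (x : 'cV[R]_n) : norm2 x = Num.sqrt (dotv x x).
Proof. by rewrite dotv_sum_sqr. Qed.

Lemma norm2_ge0 n (x : 'cV[R]_n) : 0 <= norm2 x.
Proof. exact: sqrtr_ge0. Qed.

Lemma sqr_norm2 n (x : 'cV[R]_n) : norm2 x ^+ 2 = dotv x x.
Proof. by rewrite norm2_dotv sqr_sqrtr ?dotv_ge0. Qed.

Lemma norm2Z n (c : R) (x : 'cV[R]_n) : norm2 (c *: x) = `|c| * norm2 x.
Proof.
rewrite !norm2_dotv dotvZl dotvZr mulrA -expr2 sqrtrM ?sqr_ge0 //.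
by rewrite sqrtr_sqr.
Qed.

Lemma le_norm2_sqr m n (c : R) (x : 'cV[R]_m) (y : 'cV[R]_n) : 0 <= c ->
  (norm2 x <= c * norm2 y) = (dotv x x <= c ^+ 2 * dotv y y).
Proof.
move=> c0; rewrite -!sqr_norm2 -exprMn ler_pXn2r ?nnegrE ?norm2_ge0 //.
by rewrite mulr_ge0 ?norm2_ge0.
Qed.

(** The Frobenius norm bounds the values, by Cauchy-Schwarz on each row.
    Boundedness is what makes the supremum in [mxnorm2] meaningful. *)
Lemma mxnorm2_has_ubound m n (B : 'M[R]_(m, n)) :
  has_ubound [set norm2 (B *m x) | x in [set x : 'cV[R]_n | norm2 x <= 1]].
Proof.
pose F := \sum_i dotv (row i B)^T (row i B)^T.
have F0 : 0 <= F by apply: sumr_ge0 => i _; apply: dotv_ge0.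
exists (Num.sqrt F) => _ [x /= x1 <-].
rewrite norm2_dotv ler_wsqrtr // dotv_sum_sqr; apply: ler_sum => i _.
have -> : (B *m x) i 0 = dotv (row i B)^T x.
  by rewrite /dotv trmxK -row_mul [RHS]mxE.
apply: (le_trans (dotv_cauchy_schwarz _ _)).
rewrite ler_piMr ?dotv_ge0 // -sqr_norm2.
by rewrite -(expr1n _ 2) ler_pXn2r ?nnegrE ?norm2_ge0.
Qed.

Lemma norm2_0 n : norm2 (0 : 'cV[R]_n) = 0.
Proof. by rewrite norm2_dotv /dotv mulmx0 mxE sqrtr0. Qed.

Lemma mxnorm2_ge0 m n (B : 'M[R]_(m, n)) : 0 <= mxnorm2 B.
Proof.
apply: (ub_le_sup (mxnorm2_has_ubound B)); exists 0; last first.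
  by rewrite mulmx0 norm2_0.
by rewrite /= norm2_0.
Qed.

Lemma norm2_mulmx_le m n (B : 'M[R]_(m, n)) (x : 'cV[R]_n) :
  norm2 (B *m x) <= mxnorm2 B * norm2 x.
Proof.
have [->|x0] := eqVneq x 0; first by rewrite mulmx0 !norm2_0 mulr0.
have nx : 0 < norm2 x by rewrite norm2_dotv sqrtr_gt0 dotv_gt0.
rewrite -ler_pdivrMr //.
apply: (ub_le_sup (mxnorm2_has_ubound B)); exists ((norm2 x)^-1 *: x) => /=.
  by rewrite norm2Z ger0_norm ?invr_ge0 ?norm2_ge0 // mulVf ?lt0r_neq0.
rewrite -scalemxAr norm2Z ger0_norm ?invr_ge0 ?norm2_ge0 //.
by rewrite mulrC.
Qed.

(** This bound and [mxnorm2_le] are stated for squares to keep square roots out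
    of the later computations. *)
Lemma dotv_mulmx_le m n (B : 'M[R]_(m, n)) (x : 'cV[R]_n) :
  dotv (B *m x) (B *m x) <= mxnorm2 B ^+ 2 * dotv x x.
Proof. by rewrite -le_norm2_sqr ?mxnorm2_ge0 ?norm2_mulmx_le. Qed.

Lemma mxnorm2_le m n (B : 'M[R]_(m, n)) (c : R) : 0 <= c ->
  (forall x : 'cV[R]_n, dotv (B *m x) (B *m x) <= c ^+ 2 * dotv x x) ->
  mxnorm2 B <= c.
Proof.
move=> c0 H; apply: ge_sup.
  by exists (norm2 (B *m 0)); exists 0; rewrite //= norm2_0.
move=> _ [x /= x1 <-]; apply: (le_trans (y := c * norm2 x)).
  by rewrite le_norm2_sqr.
by rewrite ler_piMr.
Qed.

Lemma mxnorm2_mul m n p (B : 'M[R]_(m, n)) (C : 'M[R]_(n, p)) :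
  mxnorm2 (B *m C) <= mxnorm2 B * mxnorm2 C.
Proof.
apply: mxnorm2_le => [|x]; first by rewrite mulr_ge0 ?mxnorm2_ge0.
rewrite -mulmxA exprMn -mulrA; apply: (le_trans (dotv_mulmx_le _ _)).
by rewrite ler_wpM2l ?sqr_ge0 ?dotv_mulmx_le.
Qed.

(** Two orthogonal projectors with the same range absorb each other on the left,
    hence by transposition on the right, so they are equal. *)
Lemma orthprojE n p (Q : 'M[R]_(n, p)) :
  orthonormal_cols Q -> orthproj Q = Q *m Q^T.
Proof.
move=> QQ; have QQQ : Q *m Q^T *m (Q *m Q^T) = Q *m Q^T.
  by rewrite mulmxA -(mulmxA Q) QQ mulmx1.
have QQt : (Q *m Q^T)^T = Q *m Q^T by rewrite trmx_mul trmxK.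
apply: xget_unique.
  split=> //; rewrite QQt; apply/andP; split; first exact: submxMl.
  by rewrite -{1}[Q^T]mul1mx -QQ -mulmxA submxMl.
move=> P [Pt PP]; rewrite Pt => /andP[/submxP[D PE] /submxP[D' QE]].
have PQ : P *m (Q *m Q^T) = P by rewrite mulmxA PE -(mulmxA D) QQ mulmx1.
have QP : (Q *m Q^T) *m P = Q *m Q^T by rewrite QE -!mulmxA PP.
by rewrite -PQ -{1}Pt -QQt -trmx_mul QP.
Qed.
End DotProduct.

(** * Square roots of positive semidefinite matrices *)

Lemma interpolation (F : fieldType) (s : seq F) (f : F -> F) :
  exists q : {poly F}, {in s, forall x, q.[x] = f x}.
Proof.
elim: s => [|y s [q qf]]; first by exists 0.
have [ys|yNs] := boolP (y \in s).
  by exists q => x; rewrite inE => /predU1P[->|]; apply: qf.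
pose w := \prod_(z <- s) ('X - z%:P).
have w0 : w.[y] != 0 by have := root_prod_XsubC s y; rewrite (negPf yNs) => /negbT.
exists (q + ((f y - q.[y]) / w.[y]) *: w) => x; rewrite !hornerE inE.
case/predU1P => [->|xs]; first by rewrite divfK // subrKC.
have /rootP -> : root w x by rewrite root_prod_XsubC.
by rewrite mulr0 addr0 qf.
Qed.

Lemma horner_mx_sym (R : comNzRingType) (n : nat) (M : 'M[R]_n.+1)
    (q : {poly R}) :
  M^T = M -> (horner_mx M q)^T = horner_mx M q.
Proof.
move=> MT; elim/poly_ind: q => [|q c IH]; first by rewrite !rmorph0 trmx0.
rewrite rmorphD rmorphM /= horner_mx_X horner_mx_C linearD /= tr_scalar_mx.
rewrite trmx_mul MT IH; congr (_ + _).
exact: comm_mx_horner.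
Qed.

(** The complex spectral theorem, with the eigenvalues pulled back to the base
    field.  The eigenvectors stay complex: an identity between polynomials in [M]
    depends on the eigenvalues alone. *)
Lemma psdmx_spectrum (R : realType) (n : nat) (M : 'M[R]_n.+1) :
  psdmx M ->
  exists (P : 'M[R[i]]_n.+1) (l : 'rV[R]_n.+1),
    [/\ P \in unitmx,
        map_mx (real_complex R) M
          = invmx P *m diag_mx (map_mx (real_complex R) l) *m P
      & forall i, 0 <= l 0 i].
Proof.
move=> [MT Mpsd]; pose MC := map_mx (real_complex R) M.
have MCh : MC \is hermsymmx.
  apply: realsym_hermsym; last first.
    by apply/mxOverP => i j; rewrite mxE; apply/complex_realP; exists (M i j).
  by apply/is_hermitianmxP; rewrite expr0 scale1r map_mx_id // /MC map_trmx MT.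
have /orthomx_spectralP := hermitian_normalmx MCh.
have /mxOverP lreal := hermitian_spectral_diag_real MCh.
have := spectral_unit MC.
move: (spectralmx MC) (spectral_diag MC) lreal => P sp lreal Pu ME.
pose l := \row_i complex.Re (sp 0 i).
have lE : sp = map_mx (real_complex R) l.
  by apply/rowP => i; rewrite !mxE; have /complex_realP[k ->] := lreal 0 i.
exists P, l; split; [exact: Pu | by rewrite -lE; exact: ME | move=> i].
(* A real root of the complex characteristic polynomial has a real
   eigenvector, on which the quadratic form is evaluated. *)
have /eigenvalueP[v vM v0] : eigenvalue M (l 0 i).
  rewrite eigenvalue_root_char -(fmorph_root (real_complex R)) map_char_poly.
  rewrite -eigenvalue_root_char; apply/eigenvalueP; exists (row i P).
    rewrite -/MC ME !mulmxA -row_mul mulmxV // row1 -rowE row_diag_mx lE.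
    by rewrite -scalemxAl -rowE mxE.
  apply/eqP => Pi0.
  have /rowP/(_ i) : delta_mx 0 i = 0 :> 'rV[R[i]]_n.+1.
    by rewrite -[LHS](mulmxK Pu) -rowE Pi0 mul0mx.
  by rewrite !mxE !eqxx => /eqP; rewrite oner_eq0.
have v0' : v^T != 0 by rewrite trmx_eq0.
have := Mpsd v^T; rewrite trmxK vM -scalemxAl mxE.
by rewrite -{1}[v]trmxK pmulr_lge0 ?dotv_gt0.
Qed.

(** A polynomial in [M] is symmetric and acts on the spectrum pointwise.  A
    fourth root [K] obtained in this way makes [K *m K] visibly positive
    semidefinite, as [x^T K K x = |K x|^2]. *)
Lemma sqrtmxP (R : realType) (n : nat) (M : 'M[R]_n) :
  psdmx M -> psdmx (sqrtmx M) /\ sqrtmx M *m sqrtmx M = M.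
Proof.
move=> Mpsd; apply: (@xgetPex _ 0 [set N | psdmx N /\ N *m N = M]%classic).
case: n M Mpsd => [|n] M Mpsd.
  by exists M; split=> //; apply/matrixP => - [].
have [P [l [Pu ME l0]]] := psdmx_spectrum Mpsd.
have MT := Mpsd.1.
have [r rE] := interpolation [seq l 0 i | i <- enum 'I_n.+1]
  (fun x => Num.sqrt (Num.sqrt x)).
have KT := horner_mx_sym r MT; set K := horner_mx M r in KT.
exists (K *m K); split.
  split; first by rewrite trmx_mul KT.
  by move=> x; rewrite -!mulmxA mulmxA -{1}KT -trmx_mul dotv_ge0.
apply: (@map_mx_inj _ _ (real_complex R)).
have -> : K *m K *m (K *m K) = horner_mx M (r ^+ 4).
  by rewrite rmorphXn /= !exprS expr0 mulr1 -!mulmxE -/K !mulmxA.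
rewrite map_horner_mx ME horner_mx_uconjC // horner_mx_diag.
congr (_ *m diag_mx _ *m _); apply/rowP => i; rewrite !mxE horner_map /=.
rewrite horner_exp rE; last by rewrite map_f ?mem_enum.
by rewrite (exprM _ 2 2) !sqr_sqrtr ?sqrtr_ge0.
Qed.

(** * Graphs over an orthogonal splitting *)

Definition orthonormal_split {R : realType} {n p q : nat}
    (Vp : 'M[R]_(n, p)) (Vq : 'M[R]_(n, q)) : Prop :=
  [/\ orthonormal_cols Vp, orthonormal_cols Vq, Vp^T *m Vq = 0
    & Vp *m Vp^T + Vq *m Vq^T = 1%:M].

Section GraphSubspace.
Context {R : realType} {n p q : nat}.
Context {Vp : 'M[R]_(n, p)} {Vq : 'M[R]_(n, q)}.
Implicit Types (E : 'M[R]_(q, p)) (Q : 'M[R]_(n, p)) (X : 'M[R]_p).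

Lemma split_dotv (x : 'cV[R]_n) : orthonormal_split Vp Vq ->
  dotv x x = dotv (Vp^T *m x) (Vp^T *m x) + dotv (Vq^T *m x) (Vq^T *m x).
Proof.
move=> [_ _ _ full].
rewrite !dotv_mull !trmxK -dotvDr.
by rewrite !mulmxA -mulmxDl full mul1mx.
Qed.

Lemma split_trmx : orthonormal_split Vp Vq -> Vq^T *m Vp = 0.
Proof. by move=> [_ _ pq _]; rewrite -[Vp]trmxK -trmx_mul pq trmx0. Qed.

Lemma graph_headK E : orthonormal_split Vp Vq -> Vp^T *m (Vp + Vq *m E) = 1%:M.
Proof. by move=> [pp _ pq _]; rewrite mulmxDr mulmxA pq pp mul0mx addr0. Qed.

Lemma graph_tailK E : orthonormal_split Vp Vq -> Vq^T *m (Vp + Vq *m E) = E.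
Proof.
move=> sp; have [_ qq _ _] := sp.
by rewrite mulmxDr mulmxA qq mul1mx split_trmx // add0r.
Qed.

(** Pythagoras, applied to the head and tail components [u] and [E u]. *)
Lemma graph_dotv E (u : 'cV[R]_p) : orthonormal_split Vp Vq ->
  dotv ((Vp + Vq *m E) *m u) ((Vp + Vq *m E) *m u)
  = dotv u u + dotv (E *m u) (E *m u).
Proof.
move=> sp; rewrite split_dotv // !mulmxA.
by rewrite graph_headK // graph_tailK // mul1mx.
Qed.

Lemma graph_gram E : orthonormal_split Vp Vq ->
  (Vp + Vq *m E)^T *m (Vp + Vq *m E) = 1%:M + E^T *m E.
Proof.
move=> sp; have [_ _ _ full] := sp; set Z := Vp + _.
have headT : Z^T *m Vp = 1%:M.
  by rewrite -[X in _ *m X]trmxK -trmx_mul graph_headK // trmx1.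
have tailT : Z^T *m Vq = E^T.
  by rewrite -[X in _ *m X]trmxK -trmx_mul graph_tailK.
rewrite -[X in X *m _]mulmx1 -full mulmxDr mulmxDl !mulmxA headT tailT mul1mx.
by rewrite -(mulmxA E^T) graph_headK // graph_tailK.
Qed.

Lemma graph_coords_gram E X Q : orthonormal_split Vp Vq ->
  orthonormal_cols Q -> Q = (Vp + Vq *m E) *m X ->
  X^T *m (1%:M + E^T *m E) *m X = 1%:M.
Proof.
by move=> sp QQ QE; rewrite -graph_gram // mulmxA -trmx_mul -QE -mulmxA -QE QQ.
Qed.

Lemma graph_coords_unit E X Q : orthonormal_split Vp Vq ->
  orthonormal_cols Q -> Q = (Vp + Vq *m E) *m X -> X \in unitmx.
Proof.
by move=> sp QQ QE; have /mulmx1_unit[] := graph_coords_gram sp QQ QE.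
Qed.

(** Taking [U = N X] with [N] the square root of [1 + E^T E] works because
    [X^T N N X = Q^T Q = 1]. *)
Lemma graph_polar E X Q : orthonormal_split Vp Vq ->
  orthonormal_cols Q -> Q = (Vp + Vq *m E) *m X ->
  exists U : 'M[R]_p, orthonormal_cols U
    /\ Q = (Vp + Vq *m E) *m invmx (sqrtmx (1%:M + E^T *m E)) *m U.
Proof.
move=> sp QQ QE; set M := 1%:M + E^T *m E.
have Mpsd : psdmx M.
  split; first by rewrite /M linearD /= trmx1 trmx_mul trmxK.
  move=> x; rewrite /M mulmxDr mulmxDl mulmx1 mulmxA -mulmxA -trmx_mul mxE.
  by rewrite addr_ge0 // dotv_ge0.
have [[NT _] NN] := sqrtmxP Mpsd; set N := sqrtmx M in NT NN *.
have UU : (N *m X)^T *m (N *m X) = 1%:M.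
  rewrite trmx_mul NT mulmxA -(mulmxA _ N N) NN.
  exact: graph_coords_gram QE.
have /mulmx1_unit[_] := UU; rewrite unitmx_mul => /andP[Nu _].
by exists (N *m X); split=> //; rewrite -mulmxA mulKmx.
Qed.

(** On the range of [Q] the difference of the projectors is the projection
    onto the tail; this ties the distance to the tail components. *)
Lemma projector_diff_mul Q : orthonormal_split Vp Vq -> orthonormal_cols Q ->
  (Q *m Q^T - Vp *m Vp^T) *m Q = Vq *m (Vq^T *m Q).
Proof.
move=> [_ _ _ full] QQ; rewrite mulmxBl -(mulmxA Q) QQ mulmx1.
by rewrite -{1}[Q]mul1mx -full mulmxDl addrAC subrr add0r mulmxA.
Qed.

(** With [y] and [w] the head and tail components of [x], the image of [x] is
    [Q t - h], where [Q t] is the projection onto the graph of the tail part of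
    [x] and [h] is the residual of its head part.  These are orthogonal, so it
    suffices to bound each by the corresponding component of [x]. *)
Lemma projector_dist_le E X Q : orthonormal_split Vp Vq ->
  orthonormal_cols Q -> Q = (Vp + Vq *m E) *m X ->
  mxnorm2 (Q *m Q^T - Vp *m Vp^T)
  <= mxnorm2 E / Num.sqrt (1 + mxnorm2 E ^+ 2).
Proof.
move=> sp QQ QE; have [pp qq pq full] := sp.
have Xu := graph_coords_unit sp QQ QE.
set e := mxnorm2 E; have e0 : 0 <= e := mxnorm2_ge0 E.
have e1 : 0 < 1 + e ^+ 2 by rewrite ltr_wpDr ?sqr_ge0.
apply: mxnorm2_le => [|x]; first by rewrite divr_ge0 ?sqrtr_ge0.
rewrite expr_div_n sqr_sqrtr ?(ltW e1) //.
pose y := Vp^T *m x; pose w := Vq^T *m x.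
have xE : x = Vp *m y + Vq *m w.
  by rewrite /y /w !mulmxA -mulmxDl full mul1mx.
pose t := Q^T *m (Vq *m w); pose h := Vp *m y - Q *m (Q^T *m (Vp *m y)).
have Qh : Q^T *m h = 0.
  by rewrite /h mulmxBr (mulmxA Q^T Q) QQ mul1mx subrr.
have -> : (Q *m Q^T - Vp *m Vp^T) *m x = Q *m t - h.
  have QQx : Q *m Q^T *m x = Q *m t + Q *m (Q^T *m (Vp *m y)).
    by rewrite [in LHS]xE mulmxDr -!(mulmxA Q) addrC.
  by rewrite mulmxBl QQx -[Vp *m _ *m x]mulmxA -/y /h opprB addrA.
have perp r : dotv (Q *m r) h = 0 by rewrite dotv_mull Qh /dotv mulmx0 mxE.
have -> : dotv (Q *m t - h) (Q *m t - h) = dotv t t + dotv h h.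
  by rewrite dotvB_orth ?perp // dotv_isometry.
rewrite (split_dotv x sp) -/y -/w.
suff [Ht Hh] : dotv t t <= e ^+ 2 / (1 + e ^+ 2) * dotv w w
            /\ dotv h h <= e ^+ 2 / (1 + e ^+ 2) * dotv y y.
  by rewrite mulrDr addrC lerD.
split.
(* [|t|^2 = (Q t) . (Vq w) = g . w], and [g] is the tail component of [Q t],
   hence shorter than it by the factor [e / sqrt (1 + e^2)]. *)
- set g := E *m (X *m t).
  have tg : dotv t t = dotv g w.
    rewrite {2}/t -dotv_mull dotvC dotv_mull {1}QE -mulmxA mulmxA.
    by rewrite graph_tailK // dotvC.
  have gt : (1 + e ^+ 2) * dotv g g <= e ^+ 2 * dotv t t.
    rewrite -[dotv t t](dotv_isometry t t QQ) QE -mulmxA graph_dotv // -/g.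
    have := dotv_mulmx_le E (X *m t); rewrite -/g -/e; lra.
  have := dotv_cauchy_schwarz g w; rewrite -tg.
  have := dotv_ge0 t; have := dotv_ge0 w; move: gt.
  set T := dotv t t; set W := dotv w w; set G := dotv g g => gt W0 T0 cs.
  rewrite mulrAC ler_pdivlMr //.
  have [->|Tn0] := eqVneq T 0; first by rewrite mul0r mulr_ge0 ?sqr_ge0.
  have Tp : 0 < T by rewrite lt_def Tn0.
  rewrite -(ler_pM2l Tp).
  have H1 : (1 + e ^+ 2) * T ^+ 2 <= (1 + e ^+ 2) * (G * W) by rewrite ler_pM2l.
  have H2 : (1 + e ^+ 2) * G * W <= e ^+ 2 * T * W by rewrite ler_wpM2r.
  by rewrite expr2 in H1; lra.
(* The residual is at most the distance from [Vp y] to any vector of the graph;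
   this multiple [u] of [y] minimizes [|y - u|^2 + e^2 |u|^2]. *)
- pose c := (1 + e ^+ 2)^-1; pose u := c *: y.
  have -> : e ^+ 2 / (1 + e ^+ 2) * dotv y y
    = (1 - c) ^+ 2 * dotv y y + e ^+ 2 * (c ^+ 2 * dotv y y).
    by rewrite /c; field; rewrite lt0r_neq0.
  set k := Vp *m y - (Vp + Vq *m E) *m u.
  have hk : dotv h h <= dotv k k.
    pose r := Q^T *m (Vp *m y) - invmx X *m u.
    have -> : k = h + Q *m r.
      by rewrite /h /r mulmxBr addrA subrK QE -mulmxA mulKVmx // /k.
    have hr : dotv h (Q *m r) = 0 by rewrite dotvC perp.
    by rewrite (dotvD_orth hr) lerDl dotv_ge0.
  apply: (le_trans hk).
  rewrite (split_dotv k sp).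
  have -> : dotv (Vp^T *m k) (Vp^T *m k)
      + dotv (Vq^T *m k) (Vq^T *m k) = (1 - c) ^+ 2 * dotv y y + dotv (E *m u) (E *m u).
    have -> : Vp^T *m k = y - u.
      by rewrite mulmxBr (mulmxA _ Vp y) pp mul1mx (mulmxA _ _ u) graph_headK ?mul1mx.
    have -> : Vq^T *m k = - (E *m u).
      rewrite mulmxBr (mulmxA _ Vp y) split_trmx // mul0mx sub0r.
      by rewrite (mulmxA _ _ u) graph_tailK.
    rewrite dotvNl dotvNr opprK.
    have -> : y - u = (1 - c) *: y by rewrite scalerBl scale1r.
    by rewrite dotvZl dotvZr; ring.
  rewrite lerD2l (le_trans (dotv_mulmx_le _ _)) // -/e.
  by rewrite /u dotvZl dotvZr (mulrA c) -expr2.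
Qed.

(** Applied to [(Vp + Vq E) u], the difference of the projectors gives [Vq E u].
    So [|E u|^2 <= dl^2 (|u|^2 + |E u|^2)], which bounds [E] once [dl < 1] is
    known from the upper bound. *)
Lemma projector_dist_ge E X Q : orthonormal_split Vp Vq ->
  orthonormal_cols Q -> Q = (Vp + Vq *m E) *m X ->
  mxnorm2 E / Num.sqrt (1 + mxnorm2 E ^+ 2)
  <= mxnorm2 (Q *m Q^T - Vp *m Vp^T).
Proof.
move=> sp QQ QE; have [pp qq pq full] := sp.
have Xu := graph_coords_unit sp QQ QE.
have := projector_dist_le sp QQ QE.
set e := mxnorm2 E; have e0 : 0 <= e := mxnorm2_ge0 E.
set D := _ - _; set dl := mxnorm2 D; have dl0 : 0 <= dl := mxnorm2_ge0 D.
have e1 : 0 < 1 + e ^+ 2 by rewrite ltr_wpDr ?sqr_ge0.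
have s1 : 0 < Num.sqrt (1 + e ^+ 2) by rewrite sqrtr_gt0.
have ss : Num.sqrt (1 + e ^+ 2) ^+ 2 = 1 + e ^+ 2 by rewrite sqr_sqrtr ?(ltW e1).
move=> dls.
have dl2 : dl ^+ 2 < 1.
  have : dl ^+ 2 <= (e / Num.sqrt (1 + e ^+ 2)) ^+ 2.
    by rewrite ler_pXn2r // nnegrE divr_ge0 // ltW.
  move/le_lt_trans; apply.
  by rewrite expr_div_n ss ltr_pdivrMr // mul1r ltrDr.
have dl1 : 0 < 1 - dl ^+ 2 by rewrite subr_gt0.
have ec : e <= dl / Num.sqrt (1 - dl ^+ 2).
  apply: mxnorm2_le => [|u]; first by rewrite divr_ge0 ?sqrtr_ge0.
  rewrite expr_div_n sqr_sqrtr ?(ltW dl1) // mulrAC ler_pdivlMr //.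
  have : dotv (E *m u) (E *m u)
      <= dl ^+ 2 * (dotv u u + dotv (E *m u) (E *m u)).
    have ZQ : (Vp + Vq *m E) *m u = Q *m (invmx X *m u).
      by rewrite QE -mulmxA mulKVmx.
    have := dotv_mulmx_le D ((Vp + Vq *m E) *m u).
    rewrite graph_dotv // ZQ mulmxA projector_diff_mul //.
    rewrite -!(mulmxA Vq) dotv_isometry // -(mulmxA _ Q) -ZQ.
    by rewrite mulmxA graph_tailK.
  lra.
rewrite ler_pdivrMr //.
have c0 : 0 <= dl / Num.sqrt (1 - dl ^+ 2) by rewrite divr_ge0 ?sqrtr_ge0.
have : e ^+ 2 <= (dl / Num.sqrt (1 - dl ^+ 2)) ^+ 2 by rewrite ler_pXn2r.
rewrite expr_div_n sqr_sqrtr ?(ltW dl1) // ler_pdivlMr // => H.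
rewrite -(ler_pXn2r (n := 2)) ?nnegrE ?mulr_ge0 ?(ltW s1) //.
by rewrite exprMn ss; lra.
Qed.

End GraphSubspace.

(** * Eigenvector bases and the eigenvalues of the filter *)

Lemma colsubM_diag (R : pzSemiRingType) (m n p : nat) (f : 'I_p -> 'I_n)
    (V : 'M[R]_(m, n)) (d : 'rV[R]_n) :
  colsub f (V *m diag_mx d) = colsub f V *m diag_mx (\row_j d 0 (f j)).
Proof. by apply/matrixP => i j; rewrite !mul_mx_diag !mxE. Qed.

Lemma colsub_orthonormal (R : realType) (n p : nat) (f : 'I_p -> 'I_n)
    (V : 'M[R]_n) :
  injective f -> orthonormal_cols V -> orthonormal_cols (colsub f V).
Proof.
move=> finj VV; apply/matrixP => i j.
rewrite mulmx_colsub mxE; have -> : (colsub f V)^T = rowsub f V^T.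
  by apply/matrixP => ? ?; rewrite !mxE.
by rewrite mul_rowsub_mx VV !mxE (inj_eq finj).
Qed.

Section ColumnSplit.
Context {R : realType} {n p : nat} (le_pn : (p <= n)%N).

Lemma sum_head_tail (F : 'I_n -> R) :
  \sum_i F i
  = \sum_(i < p) F (widen_ord le_pn i) + \sum_(j < n - p) F (ord_tail le_pn j).
Proof.
rewrite (reindex (cast_ord (subnKC le_pn))) /=; last first.
  exists (cast_ord (esym (subnKC le_pn))) => i _; first exact: cast_ordK.
  exact: cast_ordKV.
rewrite big_split_ord; congr (_ + _); apply: eq_bigr => i _.
by congr F; apply: val_inj.
Qed.

Lemma head_tail_split (V : 'M[R]_n) : orthonormal_cols V ->
  orthonormal_split (Vhead le_pn V) (Vtail le_pn V).
Proof.
move=> VV; split.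
- apply: colsub_orthonormal VV => i j /(congr1 val) /= ij; exact: val_inj.
- by apply: colsub_orthonormal VV => i j /cast_ord_inj /rshift_inj.
- apply/matrixP => i j; rewrite mxE [RHS]mxE.
  have /matrixP/(_ (widen_ord le_pn i) (ord_tail le_pn j)) := VV.
  rewrite !mxE; have -> : (widen_ord le_pn i == ord_tail le_pn j) = false.
    apply/eqP => /(congr1 val) /= ij; have := ltn_ord i.
    by rewrite ij ltnNge leq_addr.
  by move=> VVij; apply: etrans VVij; apply: eq_bigr => k _; rewrite !mxE.
- have /mulmx1C VV' := VV.
  rewrite -VV'; apply/matrixP => i j; rewrite !mxE [RHS]sum_head_tail.
  by congr (_ + _); apply: eq_bigr => k _; rewrite !mxE.
Qed.

Lemma head_mul (P V : 'M[R]_n) (g : 'I_n -> R) :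
  P *m V = V *m diag_mx (\row_i g i) ->
  P *m Vhead le_pn V = Vhead le_pn V *m Ghead le_pn g.
Proof.
move=> PV; rewrite /Vhead mulmx_colsub PV colsubM_diag; congr (_ *m diag_mx _).
by apply/rowP => j; rewrite !mxE.
Qed.

Lemma tail_mul (P V : 'M[R]_n) (g : 'I_n -> R) :
  P *m V = V *m diag_mx (\row_i g i) ->
  P *m Vtail le_pn V = Vtail le_pn V *m Gtail le_pn g.
Proof.
move=> PV; rewrite /Vtail mulmx_colsub PV colsubM_diag; congr (_ *m diag_mx _).
by apply/rowP => j; rewrite !mxE.
Qed.

End ColumnSplit.

Lemma eigenbasis_diag (R : realType) (n : nat) (S V : 'M[R]_n) (l : 'I_n -> R) :
  (forall i, S *m col i V = l i *: col i V) ->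
  S *m V = V *m diag_mx (\row_i l i).
Proof.
move=> Sv; apply/matrixP => i j; have /colP/(_ i) := Sv j.
rewrite mul_mx_diag !mxE mulrC => <-.
by apply: eq_bigr => k _; rewrite !mxE.
Qed.

Lemma horner_mx_eigenbasis (R : realType) (n : nat) (S V : 'M[R]_n.+1)
    (l : 'I_n.+1 -> R) (q : {poly R}) :
  orthonormal_cols V -> S *m V = V *m diag_mx (\row_i l i) ->
  horner_mx S q *m V = V *m diag_mx (\row_i q.[l i]).
Proof.
move=> VV SV; have [_ Vu] := mulmx1_unit VV.
have -> : S = V *m diag_mx (\row_i l i) *m invmx V by rewrite -SV mulmxK.
rewrite horner_mx_uconj // mulmxKV // horner_mx_diag; congr (_ *m diag_mx _).
by apply/rowP => j; rewrite !mxE.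
Qed.

Lemma singular_value_of_eigenvector (R : realType) (m n : nat)
    (A : 'M[R]_(m, n)) (s : R) (v : 'cV[R]_n) :
  0 <= s -> v != 0 -> A^T *m A *m v = s ^+ 2 *: v -> singular_value A s.
Proof.
move=> s0 v0 Av; split=> //; apply/eigenvalueP; exists v^T.
  apply: trmx_inj; rewrite trmx_mul trmxK [in LHS]trmx_mul trmxK Av.
  by rewrite linearZ /= trmxK.
by rewrite trmx_eq0.
Qed.

Lemma singular_value_le (R : realType) (m n : nat) (A : 'M[R]_(m, n)) (s : R) :
  singular_value A s -> s <= mxnorm2 A.
Proof.
move=> [s0 /eigenvalueP[v vA v0]].
have v0' : v^T != 0 by rewrite trmx_eq0.
rewrite -(ler_pXn2r (n := 2)) ?nnegrE ?mxnorm2_ge0 //.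
rewrite -(ler_pM2r (dotv_gt0 v0')).
apply: le_trans (dotv_mulmx_le A v^T).
have Av : A^T *m A *m v^T = s ^+ 2 *: v^T.
  by apply: trmx_inj; rewrite trmx_mul trmx_mul !trmxK vA linearZ /= trmxK.
by rewrite dotv_mull mulmxA Av dotvZr.
Qed.

Lemma sigma_min_le (R : realType) (m n : nat) (A : 'M[R]_(m, n)) (s : R) :
  singular_value A s -> sigma_min A <= s.
Proof. by move=> As; apply: ge_inf => //; exists 0 => x []. Qed.

Lemma sigma_min_ge0 (R : realType) (m n : nat) (A : 'M[R]_(m, n)) (s : R) :
  singular_value A s -> 0 <= sigma_min A.
Proof. by move=> As; apply: lb_le_inf; [exists s | move=> x []]. Qed.

Lemma cj_affine_hornerE (R : realType) (m n : nat) (A : 'M[R]_(m, n)) (x : R) :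
  (cj_affine A).[x] = (mxnorm2 A ^+ 2 - sigma_min A ^+ 2)^-1
    * (2 * x - (mxnorm2 A ^+ 2 + sigma_min A ^+ 2)).
Proof. by rewrite /cj_affine hornerZ hornerD hornerN hornerC hornerZ hornerX. Qed.

(** When [A] has a single singular value the normalizing inverse is zero by
    convention, and so is the affine polynomial. *)
Lemma cj_affine_itv (R : realType) (m n : nat) (A : 'M[R]_(m, n)) (x : R) :
  sigma_min A ^+ 2 <= x <= mxnorm2 A ^+ 2 -> -1 <= (cj_affine A).[x] <= 1.
Proof.
rewrite cj_affine_hornerE; set M := mxnorm2 A ^+ 2; set s := sigma_min A ^+ 2.
move=> /andP[sx xM]; have := le_trans sx xM; rewrite le_eqVlt => /predU1P[->|sM].
  by rewrite subrr invr0 mul0r lerN10 ler01.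
have d0 : 0 < M - s by rewrite subr_gt0.
by rewrite mulrC ler_pdivlMr // ler_pdivrMr //; apply/andP; split; lra.
Qed.

Lemma cj_affine_ndecr (R : realType) (m n : nat) (A : 'M[R]_(m, n)) (x y : R) :
  sigma_min A ^+ 2 <= mxnorm2 A ^+ 2 -> x <= y ->
  (cj_affine A).[x] <= (cj_affine A).[y].
Proof.
move=> sM xy; rewrite !cj_affine_hornerE ler_wpM2l ?invr_ge0 ?subr_ge0 //.
by rewrite lerD2r ler_pM2l.
Qed.

Lemma cj_eigenvalue_ge0 (R : realType) (m n d : nat) (A : 'M[R]_(m, n))
    (a b s : R) :
  sigma_min A <= a -> a <= b -> b <= mxnorm2 A -> singular_value A s ->
  0 <= cj_eigenvalue A a b d s.
Proof.
move=> ha hab hb As; have s0 := sigma_min_ge0 As.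
have N0 := mxnorm2_ge0 A.
have itv x : sigma_min A <= x -> x <= mxnorm2 A ->
    sigma_min A ^+ 2 <= x ^+ 2 <= mxnorm2 A ^+ 2.
  move=> sx xN; have x0 := le_trans s0 sx.
  by rewrite !ler_pXn2r ?nnegrE // sx xN.
have hs := itv s (sigma_min_le As) (singular_value_le As).
have ha' := itv a ha (le_trans hab hb).
have hb' := itv b (le_trans ha hab) hb.
have sM : sigma_min A ^+ 2 <= mxnorm2 A ^+ 2 by case/andP: hs => /le_trans; apply.
have a0 := le_trans s0 ha.
apply: cj_series_ge0; last exact: cj_affine_itv.
have /andP[la _] := cj_affine_itv ha'; have /andP[_ lb] := cj_affine_itv hb'.
apply: acos_nincr => //; apply: cj_affine_ndecr => //.
by rewrite ler_pXn2r ?nnegrE // (le_trans a0).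
Qed.

(** * Subspace iteration and Ritz values *)

Lemma invmx_mul (R : comUnitRingType) (n : nat) (B C : 'M[R]_n) :
  B \in unitmx -> C \in unitmx -> invmx (B *m C) = invmx C *m invmx B.
Proof.
move=> Bu Cu; have BCu : B *m C \in unitmx by rewrite unitmx_mul Bu.
by rewrite -[RHS](mulmxK BCu) -!mulmxA (mulKmx Bu) mulKmx.
Qed.

Lemma diag_mx_inv (F : fieldType) (n : nat) (d : 'rV[F]_n) :
  (forall i, d 0 i != 0) ->
  diag_mx d \in unitmx /\ invmx (diag_mx d) = diag_mx (map_mx GRing.inv d).
Proof.
move=> d0; have dd : diag_mx d *m diag_mx (map_mx GRing.inv d) = 1%:M.
  rewrite mulmx_diag -diag_const_mx; congr diag_mx.
  by apply/rowP => i; rewrite !mxE divff.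
have [du _] := mulmx1_unit dd; split=> //.
by rewrite -[LHS]mulmx1 -dd mulKmx.
Qed.

Lemma mxnorm2_diag_le (R : realType) (n : nat) (d : 'rV[R]_n) (c : R) :
  0 <= c -> (forall i, 0 <= d 0 i <= c) -> mxnorm2 (diag_mx d) <= c.
Proof.
move=> c0 dc; apply: mxnorm2_le => // x.
rewrite !dotv_sum_sqr mulr_sumr; apply: ler_sum => i _.
have /andP[d0 di] := dc i.
by rewrite mul_diag_mx mxE exprMn ler_wpM2r ?sqr_ge0 // ler_pXn2r ?nnegrE.
Qed.

Section SubspaceIteration.
Context {R : realType} {n p : nat} (le_pn : (p <= n)%N).
Context {V : 'M[R]_n} {g : 'I_n -> R} {V0 : 'M[R]_(n, p)}.

Lemma Emx0 : Emx le_pn V g V0 0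
  = (Vtail le_pn V)^T *m V0 *m invmx ((Vhead le_pn V)^T *m V0).
Proof. by rewrite /Emx !expr0 mul1mx invmx1 mulmx1. Qed.

Lemma EmxS (k : nat) : Ghead le_pn g \in unitmx ->
  Emx le_pn V g V0 k.+1
  = Gtail le_pn g *m Emx le_pn V g V0 k *m invmx (Ghead le_pn g).
Proof.
move=> Gu; rewrite /Emx; set E0 := _ *m invmx (_ *m V0).
have Gku : Ghead le_pn g ^+ k \in unitmx.
  by elim: k => [|k IH]; rewrite ?unitmx1 // exprS unitmx_mul Gu.
have -> : invmx (Ghead le_pn g ^+ k.+1)
    = invmx (Ghead le_pn g ^+ k) *m invmx (Ghead le_pn g).
  by rewrite exprS invmx_mul.
by rewrite exprS !mulmxA.
Qed.

(** The start of the induction: an invertible head makes any matrix a basis of a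
    graph, with slope tail times inverse head. *)
Lemma graph_of_mx (Y : 'M[R]_(n, p)) : orthonormal_cols V ->
  (Vhead le_pn V)^T *m Y \in unitmx ->
  Y = (Vhead le_pn V + Vtail le_pn V *m
        ((Vtail le_pn V)^T *m Y *m invmx ((Vhead le_pn V)^T *m Y)))
      *m ((Vhead le_pn V)^T *m Y).
Proof.
move=> VV Yu; have [_ _ _ full] := head_tail_split le_pn VV.
rewrite mulmxDl -[X in _ + X]mulmxA mulmxKV // !mulmxA -mulmxDl full.
by rewrite mul1mx.
Qed.

(** The triangular factor is invertible because the head of [Q T] is [X]. *)
Lemma thin_QR_graph (Y Q : 'M[R]_(n, p)) (E : 'M[R]_(n - p, p))
    (X T : 'M[R]_p) :
  orthonormal_cols V -> thin_QR Y Q T -> X \in unitmx ->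
  Y = (Vhead le_pn V + Vtail le_pn V *m E) *m X ->
  exists X', Q = (Vhead le_pn V + Vtail le_pn V *m E) *m X'.
Proof.
move=> VV [YQ _ _] Xu YE; have sp := head_tail_split le_pn VV.
have /mulmx1_unit[_ Tu] :
    (invmx X *m ((Vhead le_pn V)^T *m Q)) *m T = 1%:M.
  by rewrite -!mulmxA -YQ YE (mulmxA _ _ X) graph_headK // mul1mx mulVmx.
by exists (X *m invmx T); rewrite mulmxA -YE YQ mulmxK.
Qed.

Lemma cj_step_graph (m k : nat) (A : 'M[R]_(m, n)) (P : 'M[R]_n)
    (Vprev : 'M[R]_(n, p)) (X : 'M[R]_p) (it : cj_iterate R m n p) :
  orthonormal_cols V -> P *m V = V *m diag_mx (\row_i g i) ->
  Ghead le_pn g \in unitmx -> X \in unitmx ->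
  Vprev = (Vhead le_pn V + Vtail le_pn V *m Emx le_pn V g V0 k) *m X ->
  cj_step A P Vprev it ->
  exists X', cjQ1 it
    = (Vhead le_pn V + Vtail le_pn V *m Emx le_pn V g V0 k.+1) *m X'.
Proof.
move=> VV PV Gu Xu VE [YE [qr _ _ _ _]].
apply: (thin_QR_graph VV qr (X := Ghead le_pn g *m X)).
  by rewrite unitmx_mul Gu.
rewrite YE VE EmxS // !mulmxDl mulmxDr !mulmxA (head_mul _ PV) (tail_mul _ PV).
by rewrite mulmxKV.
Qed.

Lemma cj_feast_graph (m : nat) (A : 'M[R]_(m, n)) (P : 'M[R]_n)
    (it : nat -> cj_iterate R m n p) :
  orthonormal_cols V -> P *m V = V *m diag_mx (\row_i g i) ->
  Ghead le_pn g \in unitmx -> (Vhead le_pn V)^T *m V0 \in unitmx ->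
  cj_feast A P V0 it ->
  forall k, exists X, cjQ1 (it k.+1)
    = (Vhead le_pn V + Vtail le_pn V *m Emx le_pn V g V0 k.+1) *m X.
Proof.
move=> VV PV Gu V0u [it0 steps] k.
suff [X Xu VE] : exists2 X, X \in unitmx & cjVhat (it k)
    = (Vhead le_pn V + Vtail le_pn V *m Emx le_pn V g V0 k) *m X.
  exact: (cj_step_graph VV PV Gu Xu VE (steps k)).
elim: k => [|k [X Xu VE]].
  exists ((Vhead le_pn V)^T *m V0) => //.
  by rewrite it0 Emx0 -graph_of_mx.
have [X' QE] := cj_step_graph VV PV Gu Xu VE (steps k).
have [_ [[_ QQ _] _ [_ _ WW _] _ ->]] := steps k.
have X'u := graph_coords_unit (head_tail_split le_pn VV) QQ QE.
have [_ Wu] := mulmx1_unit WW.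
exists (X' *m cjVbar (it k.+1)); first by rewrite unitmx_mul X'u.
by rewrite QE mulmxA.
Qed.

Lemma Emx_contraction (g0 g1 : R) (k : nat) :
  0 < g0 -> 0 <= g1 ->
  (forall i, g0 <= g (widen_ord le_pn i)) ->
  (forall j, 0 <= g (ord_tail le_pn j) <= g1) ->
  mxnorm2 (Emx le_pn V g V0 k)
  <= (g1 / g0) ^+ k * mxnorm2 (Emx le_pn V g V0 0).
Proof.
move=> g0p g1p hhead htail.
have head_gt0 i : 0 < g (widen_ord le_pn i) := lt_le_trans g0p (hhead i).
have [|Gu Ginv] := @diag_mx_inv R p (\row_j g (widen_ord le_pn j)).
  by move=> i; rewrite mxE lt0r_neq0.
elim: k => [|k IH]; first by rewrite expr0 mul1r.
rewrite EmxS // exprS.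
have -> : g1 / g0 * (g1 / g0) ^+ k * mxnorm2 (Emx le_pn V g V0 0)
  = g1 * ((g1 / g0) ^+ k * mxnorm2 (Emx le_pn V g V0 0)) * g0^-1 by ring.
apply: (le_trans (mxnorm2_mul _ _)).
apply: ler_pM; rewrite ?mxnorm2_ge0 //.
  apply: (le_trans (mxnorm2_mul _ _)); apply: ler_pM; rewrite ?mxnorm2_ge0 //.
  by apply: mxnorm2_diag_le => // j; rewrite mxE.
rewrite /Ghead Ginv; apply: mxnorm2_diag_le => [|i]; first by rewrite invr_ge0 ltW.
by rewrite !mxE invr_ge0 (ltW (head_gt0 i)) lef_pV2 ?posrE ?hhead.
Qed.

End SubspaceIteration.

(** There are only [p - 1] linear conditions on [p] unknowns. *)
Lemma common_zero (F : fieldType) (p : nat) (r : 'I_p -> 'rV[F]_p) (i0 : 'I_p) :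
  exists2 x : 'cV[F]_p, x != 0 & forall i, i != i0 -> r i *m x = 0.
Proof.
pose B := \matrix_i (if i == i0 then 0 else r i).
have : \det B == 0.
  apply/det0P; exists (delta_mx 0 i0).
    apply/eqP => /rowP/(_ i0); rewrite !mxE !eqxx; exact/eqP/oner_neq0.
  by rewrite -rowE rowK eqxx.
rewrite -det_tr => /det0P[v v0 vB]; exists v^T; first by rewrite trmx_eq0.
move=> i ii0; have : row i (B *m v^T) = 0.
  by rewrite -[B]trmxK -trmx_mul vB trmx0 row0.
by rewrite row_mul rowK (negPf ii0).
Qed.

Section RitzValues.
Context {R : realType} {m n p : nat} (le_pn : (p <= n)%N).
Context {A : 'M[R]_(m, n)} {V : 'M[R]_n} {sigma : 'I_n -> R}.
Local Notation Vp := (Vhead le_pn V).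
Local Notation Vq := (Vtail le_pn V).

(** Head and tail are invariant under [A^T A], so [A] maps them to orthogonal
    subspaces. *)
Lemma dotv_Amul_split (w : 'cV[R]_n) : orthonormal_cols V ->
  A^T *m A *m V = V *m diag_mx (\row_i sigma i ^+ 2) ->
  dotv (A *m w) (A *m w)
  = \sum_(j < p) sigma (widen_ord le_pn j) ^+ 2 * (Vp^T *m w) j 0 ^+ 2
    + dotv (A *m (Vq *m (Vq^T *m w))) (A *m (Vq *m (Vq^T *m w))).
Proof.
move=> VV SV; have [pp qq pq full] := head_tail_split le_pn VV.
set y := Vp^T *m w; set z := Vq^T *m w.
have -> : A *m w = A *m (Vp *m y) + A *m (Vq *m z).
  by rewrite -mulmxDr /y /z (mulmxA Vp) (mulmxA Vq) -mulmxDl full mul1mx.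
have Sp (u : 'cV_p) := congr1 (mulmx^~ u) (head_mul le_pn SV).
have Sq (u : 'cV_(n - p)) := congr1 (mulmx^~ u) (tail_mul le_pn SV).
rewrite /= in Sp Sq.
rewrite dotvD_orth.
  congr (_ + _); rewrite dotv_mull (mulmxA A^T) mulmxA Sp -mulmxA.
  rewrite dotv_isometry // dotv_diag; apply: eq_bigr => j _.
  by rewrite mxE.
rewrite dotv_mull (mulmxA A^T) mulmxA Sq -mulmxA dotv_mull (mulmxA Vp^T) pq.
by rewrite mul0mx /dotv mulmx0 mxE.
Qed.

Lemma dotv_Amul_ritz (Q : 'M[R]_(n, p)) (Q2 : 'M[R]_(m, p)) (B Ub W : 'M[R]_p)
    (sh : 'rV[R]_p) (x : 'cV[R]_p) :
  A *m Q = Q2 *m B -> orthonormal_cols Q2 -> square_SVD B Ub sh W ->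
  dotv (A *m (Q *m x)) (A *m (Q *m x))
  = \sum_j sh 0 j ^+ 2 * (W^T *m x) j 0 ^+ 2.
Proof.
move=> AQ Q2Q2 [BE UU _ _].
rewrite mulmxA AQ BE -!mulmxA dotv_isometry // dotv_isometry // dotv_sum_sqr.
by apply: eq_bigr => j _; rewrite mul_diag_mx mxE exprMn.
Qed.

(** A Courant-Fischer argument in one step.  For each [j <> i] one linear
    condition is imposed on [x]: either its coordinate on the [j]-th Ritz vector
    vanishes, or the [j]-th coordinate of its head does.  The choice depends on
    how [sigma_j] compares with [sigma_i], and the ordering hypothesis makes
    each surviving Ritz coordinate belong to a Ritz value on the right side of
    the [i]-th one.  At a common zero [x <> 0] the
    energy [|A Q x|^2] separates the [i]-th Ritz value from [sigma_i]. *)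
Lemma ritz_value_error (Q : 'M[R]_(n, p)) (Q2 : 'M[R]_(m, p))
    (B Ub W : 'M[R]_p) (sh : 'rV[R]_p) (s : {perm 'I_p}) (i : 'I_p) :
  orthonormal_cols V ->
  A^T *m A *m V = V *m diag_mx (\row_i sigma i ^+ 2) ->
  (forall i, 0 <= sigma i) -> sigma (widen_ord le_pn i) <= mxnorm2 A ->
  orthonormal_cols Q -> A *m Q = Q2 *m B -> orthonormal_cols Q2 ->
  square_SVD B Ub sh W ->
  (forall i j : 'I_p,
     sigma (widen_ord le_pn i) < sigma (widen_ord le_pn j) ->
     sh 0 (s i) <= sh 0 (s j)) ->
  `|sh 0 (s i) ^+ 2 - sigma (widen_ord le_pn i) ^+ 2|
  <= mxnorm2 A ^+ 2 * mxnorm2 (Q *m Q^T - Vp *m Vp^T) ^+ 2.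
Proof.
move=> VV SV sg0 sgA QQ AQ Q2Q2 svd ord.
have [_ _ WW sh0] := svd; have sp := head_tail_split le_pn VV.
have [pp qq _ _] := sp.
set eps := mxnorm2 (_ - _); set N := mxnorm2 A in sgA *.
pose sg j := sigma (widen_ord le_pn j).
have WtW : orthonormal_cols W^T.
  by rewrite /orthonormal_cols trmxK; apply: mulmx1C.
pose C := Vp^T *m Q.
have Cz x : dotv x x = dotv (C *m x) (C *m x)
    + dotv (Vq^T *m (Q *m x)) (Vq^T *m (Q *m x)).
  by rewrite -[LHS](dotv_isometry x x QQ) (split_dotv _ sp) mulmxA.
have zeps x : dotv (Vq^T *m (Q *m x)) (Vq^T *m (Q *m x)) <= eps ^+ 2 * dotv x x.
  rewrite -(dotv_isometry _ _ qq) -[dotv x x](dotv_isometry x x QQ).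
  have -> : Vq *m (Vq^T *m (Q *m x)) = (Q *m Q^T - Vp *m Vp^T) *m (Q *m x).
    by rewrite [RHS]mulmxA (projector_diff_mul sp QQ) -!mulmxA.
  exact: dotv_mulmx_le.
have Az x : dotv (A *m (Vq *m (Vq^T *m (Q *m x)))) (A *m (Vq *m (Vq^T *m (Q *m x))))
    <= N ^+ 2 * (eps ^+ 2 * dotv x x).
  apply: (le_trans (dotv_mulmx_le _ _)); rewrite ler_wpM2l ?sqr_ge0 //.
  by rewrite dotv_isometry.
have energy x : \sum_j sh 0 (s j) ^+ 2 * (W^T *m x) (s j) 0 ^+ 2
  = \sum_j sg j ^+ 2 * (C *m x) j 0 ^+ 2
    + dotv (A *m (Vq *m (Vq^T *m (Q *m x)))) (A *m (Vq *m (Vq^T *m (Q *m x)))).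
  have := dotv_Amul_ritz x AQ Q2Q2 svd.
  rewrite (reindex_inj (@perm_inj _ s)) /= => <-.
  by rewrite (dotv_Amul_split _ VV SV) mulmxA.
have Wnorm x : \sum_j (W^T *m x) (s j) 0 ^+ 2 = dotv x x.
  rewrite -[RHS](dotv_isometry x x WtW) dotv_sum_sqr.
  by rewrite [RHS](reindex_inj (@perm_inj _ s)).
have vec (K : pred 'I_p) : exists2 x : 'cV[R]_p, x != 0 & forall j, j != i ->
    if K j then (W^T *m x) (s j) 0 = 0 else (C *m x) j 0 = 0.
  have [x x0 xP] := common_zero (fun j => if K j then row (s j) W^T else row j C) i.
  exists x => // j /xP.
  by case: (K j); rewrite -row_mul => /rowP/(_ 0); rewrite !mxE.
rewrite -/(sg i) ler_distl; apply/andP; split.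
- have [x x0 xP] := vec (fun j => sg i <= sg j).
  rewrite -(ler_pM2r (dotv_gt0 x0)).
  have H1 : \sum_j sh 0 (s j) ^+ 2 * (W^T *m x) (s j) 0 ^+ 2
      <= sh 0 (s i) ^+ 2 * dotv x x.
    rewrite -Wnorm mulr_sumr; apply: ler_sum => j _.
    have [->//|/xP] := eqVneq j i; case: leP => [_ ->|sij _].
      by rewrite expr0n !mulr0.
    by rewrite ler_wpM2r ?sqr_ge0 // ler_pXn2r ?nnegrE // ord.
  have H2 : sg i ^+ 2 * dotv (C *m x) (C *m x)
      <= \sum_j sg j ^+ 2 * (C *m x) j 0 ^+ 2.
    rewrite dotv_sum_sqr mulr_sumr; apply: ler_sum => j _.
    have [->//|/xP] := eqVneq j i; case: leP => [sij _|_ ->].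
      by rewrite ler_wpM2r ?sqr_ge0 // ler_pXn2r ?nnegrE // sg0.
    by rewrite expr0n !mulr0.
  have H3 : sg i ^+ 2 * dotv (Vq^T *m (Q *m x)) (Vq^T *m (Q *m x))
      <= N ^+ 2 * (eps ^+ 2 * dotv x x).
    apply: ler_pM; rewrite ?sqr_ge0 ?dotv_ge0 //.
    by rewrite ler_pXn2r ?nnegrE ?mxnorm2_ge0 ?sg0.
  have := energy x; have := dotv_ge0 (A *m (Vq *m (Vq^T *m (Q *m x)))).
  have := congr1 (fun y => sg i ^+ 2 * y) (Cz x); rewrite /= mulrDr.
  lra.
- have [x x0 xP] := vec (fun j => sg j <= sg i).
  rewrite -(ler_pM2r (dotv_gt0 x0)).
  have H1 : sh 0 (s i) ^+ 2 * dotv x x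
      <= \sum_j sh 0 (s j) ^+ 2 * (W^T *m x) (s j) 0 ^+ 2.
    rewrite -Wnorm mulr_sumr; apply: ler_sum => j _.
    have [->//|/xP] := eqVneq j i; case: leP => [_ ->|sij _].
      by rewrite expr0n !mulr0.
    by rewrite ler_wpM2r ?sqr_ge0 // ler_pXn2r ?nnegrE // ord.
  have H2 : \sum_j sg j ^+ 2 * (C *m x) j 0 ^+ 2
      <= sg i ^+ 2 * dotv (C *m x) (C *m x).
    rewrite dotv_sum_sqr mulr_sumr; apply: ler_sum => j _.
    have [->//|/xP] := eqVneq j i; case: leP => [sij _|_ ->].
      by rewrite ler_wpM2r ?sqr_ge0 // ler_pXn2r ?nnegrE // sg0.
    by rewrite expr0n !mulr0.
  have H3 : sg i ^+ 2 * dotv (C *m x) (C *m x) <= sg i ^+ 2 * dotv x x.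
    by rewrite ler_wpM2l ?sqr_ge0 // (Cz x) lerDl dotv_ge0.
  have := energy x; have := Az x; lra.
Qed.

End RitzValues.

(** * Convergence of the solver *)

Theorem theorem5p1 (R : realType) (m n p nsv d : nat)
    (A : 'M[R]_(m, n.+1)) (a b : R)
    (sigma gamma : 'I_n.+1 -> R) (V : 'M[R]_n.+1)
    (V0 : 'M[R]_(n.+1, p)) (it : nat -> cj_iterate R m n.+1 p)
    (hmn : (n.+1 <= m)%N)
    (ha : sigma_min A <= a) (hab : a <= b) (hb : b <= mxnorm2 A)
    (hV : orthonormal_cols V)
    (hsigma : forall i, 0 <= sigma i)
    (heig : forall i, A^T *m A *m col i V = sigma i ^+ 2 *: col i V)
    (hgamma : forall i, gamma i = cj_eigenvalue A a b d (sigma i))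
    (hnsv : forall i : 'I_n.+1, (i < nsv)%N = (a <= sigma i <= b))
    (hdecr : forall i j : 'I_n.+1, (i <= j)%N -> gamma j <= gamma i)
    (hp0 : (0 < p)%N) (hnsvp : (nsv <= p)%N) (hp : (p < n.+1)%N)
    (hV0 : orthonormal_cols V0)
    (hit : cj_feast A (cj_projector A a b d) V0 it)
    (hinv : (Vhead (ltnW hp) V)^T *m V0 \in unitmx)
    (hgap : gamma (inord p) < gamma (inord p.-1)) :
  let Vp := Vhead (ltnW hp) V in
  let Vperp := Vtail (ltnW hp) V in
  let E := Emx (ltnW hp) V gamma V0 in
  let ratio := gamma (inord p) / gamma (inord p.-1) in
  forall k : nat, (0 < k)%N ->
  let M := 1%:M + (E k)^T *m E k in
  let eps := span_dist (cjQ1 (it k)) Vp in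
  [/\ exists U : 'M[R]_p,
        orthonormal_cols U
        /\ cjQ1 (it k) = (Vp + Vperp *m E k) *m invmx (sqrtmx M) *m U,
      mxnorm2 (E k) <= ratio ^+ k * mxnorm2 (E 0%N),
      eps = mxnorm2 (E k) / Num.sqrt (1 + mxnorm2 (E k) ^+ 2),
      eps <= ratio ^+ k * mxnorm2 (E 0%N)
    & forall s : {perm 'I_p},
        (forall i j : 'I_p,
            sigma (widen_ord (ltnW hp) i) < sigma (widen_ord (ltnW hp) j) ->
            cjsigma (it k) 0 (s i) <= cjsigma (it k) 0 (s j)) ->
        forall i : 'I_p, (i < nsv)%N ->
          `|cjsigma (it k) 0 (s i) ^+ 2 - sigma (widen_ord (ltnW hp) i) ^+ 2|
          <= mxnorm2 A ^+ 2 * (3 * eps ^+ 2 + eps ^+ 4)].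
Proof.
move=> Vp Vperp E ratio [//|k] _ M eps.
have [_ Vu] := mulmx1_unit hV.
have col_neq0 i : col i V != 0.
  apply: contraTneq Vu => Vi0; rewrite -unitmx_tr.
  apply/negP => VTu; have : delta_mx 0 i *m V^T = 0 :> 'rV[R]_n.+1.
    by rewrite -rowE -tr_col Vi0 trmx0.
  move/(congr1 (mulmx^~ (invmx V^T))); rewrite mulmxK // mul0mx.
  by move/rowP/(_ i); rewrite !mxE !eqxx => /eqP; rewrite oner_eq0.
have sv i : singular_value A (sigma i).
  exact: singular_value_of_eigenvector (hsigma i) (col_neq0 i) (heig i).
have g0 i : 0 <= gamma i by rewrite hgamma; apply: cj_eigenvalue_ge0.
have SV := eigenbasis_diag heig.
have PV : cj_projector A a b d *m V = V *m diag_mx (\row_i gamma i).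
  have lSV := horner_mx_eigenbasis (cj_affine A) hV SV.
  rewrite (horner_mx_eigenbasis _ hV lSV); congr (_ *m diag_mx _).
  by apply/rowP => i; rewrite !mxE hgamma.
have gp_gt0 : 0 < gamma (inord p.-1) := le_lt_trans (g0 _) hgap.
have ghead i : gamma (inord p.-1) <= gamma (widen_ord (ltnW hp) i).
  apply: hdecr; rewrite /= inordK; last by rewrite (leq_ltn_trans (leq_pred p)).
  by rewrite -ltnS prednK.
have gtail j : 0 <= gamma (ord_tail (ltnW hp) j) <= gamma (inord p).
  by rewrite g0 hdecr //= inordK // leq_addr.
have Gu : Ghead (ltnW hp) gamma \in unitmx.
  by apply: (diag_mx_inv _).1 => i; rewrite mxE lt0r_neq0 // (lt_le_trans gp_gt0).
have sp := head_tail_split (ltnW hp) hV.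
have [X QE] := cj_feast_graph hV PV Gu hinv hit k.
have [_ [[_ QQ _] [AQ Q2Q2 _] svd _ _]] := hit.2 k.
have epsE : eps = mxnorm2 (cjQ1 (it k.+1) *m (cjQ1 (it k.+1))^T - Vp *m Vp^T).
  by have [pp _ _ _] := sp; rewrite /eps /span_dist !orthprojE.
have epsF : eps = mxnorm2 (E k.+1) / Num.sqrt (1 + mxnorm2 (E k.+1) ^+ 2).
  rewrite epsE; apply/eqP; rewrite eq_le.
  by rewrite (projector_dist_le sp QQ QE) (projector_dist_ge sp QQ QE).
have contraction : mxnorm2 (E k.+1) <= ratio ^+ k.+1 * mxnorm2 (E 0%N).
  exact: Emx_contraction.
split=> //.
- exact: graph_polar sp QQ QE.
- apply: le_trans contraction; rewrite epsF ler_pdivrMr; last first.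
    by rewrite sqrtr_gt0 ltr_wpDr ?sqr_ge0.
  rewrite ler_peMr ?mxnorm2_ge0 // -[leLHS]sqrtr1 ler_wsqrtr //.
  by rewrite lerDl sqr_ge0.
- move=> s ord i _.
  have := ritz_value_error hV SV hsigma (singular_value_le (sv _)) QQ AQ Q2Q2 svd ord.
  rewrite -epsE => /(_ i)/le_trans; apply.
  rewrite ler_wpM2l ?sqr_ge0 //.
  have := sqr_ge0 eps; have : 0 <= eps ^+ 4 by rewrite (exprM _ 2 2) sqr_ge0.
  lra.
Qed.
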